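(* For any real $x>0$, we have $$\exp\left(\frac{1}{12x+6(\sqrt2-1)}\right)\le\frac{\Pi(x)}{S_0(x)}\le\exp\left(\frac{1}{12x}\right),$$ while for any real $x\ge0$ $$\exp\left(\frac{1}{12x+6(\sqrt{10}-1)}\right)\le\frac{\Pi(x)}{S_1(x)}\le\exp\left(\frac{1}{12x+12}\right)$$ holds.
   Context: $\Pi(x) := \Gamma(x+1)$ for real $x\ge0$, with $\Gamma$ Euler's gamma function. For $d\in\mathbb{R}$ and real $x>-d$, $S_d(x) := \sqrt{2\pi}\,e^{-d}\,(x+d)^{x+\frac12}\,e^{-x}$; here $d=0$ and $d=1$ are used. *)

(* Defs.v *)
From HB Require Import structures.
From mathcomp Require Import all_boot all_order all_algebra.
From mathcomp Require Import all_classical all_reals all_analysis.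

Set Implicit Arguments.
Unset Strict Implicit.
Unset Printing Implicit Defensive.

Import Order.TTheory GRing.Theory Num.Theory.
Import numFieldNormedType.Exports.

Local Open Scope classical_set_scope.
Local Open Scope ring_scope.

(* Euler's integral of the second kind, hence Euler's gamma function only for
   x > 0; a divergent integral has the junk value 0. *)
Definition Gamma (R : realType) (x : R) : R :=
  \int[lebesgue_measure]_(t in `]0, +oo[) (t `^ (x - 1) * expR (- t)).

Definition Pi (R : realType) (x : R) : R := Gamma (x + 1).

(* Meaningful for x > - d, where the base of the real power is positive. *)
Definition S_ (R : realType) (d x : R) : R :=
  Num.sqrt (2 * pi) * expR (- d) * (x + d) `^ (x + 2^-1) * expR (- x).

(* Main.v *)
Require Import Defs.
From HB Require Import structures.
From mathcomp Require Import all_boot all_order all_algebra.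
From mathcomp Require Import all_classical all_reals all_analysis.
From mathcomp Require Import measurable_realfun zify ring lra.

(** The quotient [Pi x / S_ 0 x] is compared with its limit [1] along the
    translates [x + n].  Write [stirling_log x] for its logarithm.  By the
    functional equation of Gamma the decrement
    [stirling_log x - stirling_log (x + 1)] is the elementary expression
    [(x + 1/2) * ln ((x + 1) / x) - 1].  With [u = 1 / (2 x + 1)] it equals
    [(ln (1 + u) - ln (1 - u)) / (2 u) - 1], that is
    [u^2 / 3 + u^4 / 5 + ...]: it is at least its first term [u^2 / 3], and at
    most the geometric series [(u^2 + u^4 + ...) / 3], which sums to
    [1 / (12 x) - 1 / (12 (x + 1))].  Summing decrements from [x] to infinity
    gives the upper bound [1 / (12 x)] ([stirling_log_le]).  For the lower
    bound the decrement of [1 / (12 x + 6 s)] is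
    [1 / (3 ((y + s)^2 - 1))] with [y = 2 x + 1], which is below
    [1 / (3 y^2)] as soon as [2 y s + s^2 >= 1]; the left side grows with [y],
    so it suffices to check the least [y] of interest
    ([stirling_log_ge]).  For [S_ 0] this is [y = 1], and the optimal [s] is
    [sqrt 2 - 1].  Since [Pi x / S_ 1 x] is [Pi (x + 1) / S_ 0 (x + 1)], the
    second pair of bounds concerns the same quotient at [x + 1 >= 1], where
    [y >= 3] and the optimal [s] is [sqrt 10 - 3].

    Summation needs [stirling_log (x + n)] to tend to [0] for every real
    [x > 0] ([stirling_log_cvg0]).  The decrement bounds give a limit, which
    is [1]-periodic in [x].  The inequality
    [Gamma (x + r) <= x ^ r * Gamma x] for [0 <= r <= 1] ([GammaD_le]) shows
    that this limit does not increase from [x] to [x + r]; a periodic function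
    with this property is constant.  The constant is found from the
    duplication formula at integers ([Gamma_double]), where
    [Gamma (1/2) = sqrt pi] comes from the Gaussian integral: in logarithms it
    expresses the limit as the sum of the limit with itself.

    The facts on Gamma are obtained for extended real integrals, so that
    finiteness is a consequence of the functional equation and of the
    inequality above and is not required beforehand. *)

Set Implicit Arguments.
Unset Strict Implicit.
Unset Printing Implicit Defensive.

Import Order.TTheory GRing.Theory Num.Theory.
Import numFieldNormedType.Exports.

Local Open Scope ring_scope.

(** * The Gamma integral *)

Section gamma.
Local Open Scope classical_set_scope.
Local Open Scope ring_scope.
Context {R : realType}.
Local Notation mu := (@lebesgue_measure R).
Implicit Types x t a : R.

(** Monotone convergence along an exhaustion of the open half line by compact
    intervals, on which continuous integrands can be handled by the fundamental
    theorem of calculus even if they are singular at [0]. *)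
Lemma cvg_integral_exhaust (a b : R^nat) (f : R -> \bar R) :
  (forall n, 0 < a n) -> nonincreasing_seq a -> a @ \oo --> 0 ->
  nondecreasing_seq b -> b @ \oo --> +oo ->
  measurable_fun [set: R] f -> (forall t, 0 < t -> (0 <= f t)%E) ->
  (\int[mu]_(t in `[a n, b n]) f t)%E @[n --> \oo]
    --> (\int[mu]_(t in `]0%R, +oo[) f t)%E.
Proof.
move=> a0 adec acvg binc bcvg mf f0.
have -> : `]0, +oo[%classic = \bigcup_n `[a n, b n]%classic.
  apply/seteqP; split => t /=.
    rewrite in_itv/= andbT => t0.
    have : \forall n \near \oo, a n <= t /\ t <= b n.
      near=> n; split; near: n.
        exact: cvgr_le acvg t t0.
      by move/cvgryPge : bcvg; exact.
    by case=> n _ /(_ n (leqnn n)) [atn tbn]; exists n; rewrite //= in_itv/= atn.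
  case=> n _ /=; rewrite in_itv/= => /andP[at_ _].
  by rewrite in_itv/= andbT (lt_le_trans _ at_).
apply: ge0_nondecreasing_set_cvg_integral => //.
- move=> m n mn; rewrite subsetEset => t /=; rewrite !in_itv/= => /andP[h1 h2].
  by rewrite (le_trans (adec _ _ mn) h1) (le_trans h2 (binc _ _ mn)).
- by move=> n; exact: measurable_funTS.
- move=> n t /=; rewrite in_itv/= => /andP[h1 _].
  by apply: f0; rewrite (lt_le_trans _ h1).
Unshelve. all: by end_near. Qed.

Definition gamma_fun (x t : R) : R := t `^ (x - 1) * expR (- t).

(** The Gamma integral as an extended real, meaningful before its convergence
    is known. *)
Definition eGamma (x : R) : \bar R :=
  (\int[mu]_(t in `]0%R, +oo[) (gamma_fun x t)%:E)%E.

Lemma GammaE (x : R) : Gamma x = fine (eGamma x).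
Proof. by []. Qed.

Lemma gamma_fun_ge0 (x t : R) : 0 <= gamma_fun x t.
Proof. by rewrite mulr_ge0 ?powR_ge0 ?expR_ge0. Qed.

Lemma measurable_gamma_fun (x : R) : measurable_fun setT (gamma_fun x).
Proof.
apply: measurable_funM; first exact: measurable_powR.
by apply: (measurableT_comp (@measurable_expR R)); exact: oppr_measurable.
Qed.

Lemma measurable_EFin_gamma_fun (x : R) : measurable_fun setT (EFin \o gamma_fun x).
Proof. by apply/measurable_EFinP; exact: measurable_gamma_fun. Qed.

Lemma eGamma_ge0 (x : R) : (0 <= eGamma x)%E.
Proof. by apply: integral_ge0 => t _; rewrite lee_fin gamma_fun_ge0. Qed.

Lemma gamma_funS (x t : R) : 0 < t -> gamma_fun (x + 1) t = t * gamma_fun x t.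
Proof.
move=> t0; rewrite /gamma_fun addrK mulrA; congr (_ * _).
rewrite [in LHS](_ : x = 1 + (x - 1)); last by ring.
by rewrite [LHS]powRD ?(gt_eqF t0) ?implybT// powRr1 ?ltW.
Qed.

Lemma is_derive_gamma_fun (x t : R) : 0 < t ->
  is_derive t 1 (gamma_fun (x + 1)) (x * gamma_fun x t - gamma_fun (x + 1) t).
Proof.
move=> t0; rewrite /gamma_fun addrK.
have h1 := is_derive1_powR x t0.
have h2 : is_derive t 1 (fun t => expR (- t)) (- expR (- t)).
  have h3 := @is_derive1_comp R expR (fun t => - t) t.
  by apply: is_derive_eq; rewrite mulrN1.
apply: is_derive_eq; rewrite /GRing.scale/=; ring.
Qed.

Lemma continuous_gamma_fun (x t : R) : 0 < t -> {for t, continuous (gamma_fun x)}.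
Proof.
move=> t0; apply: differentiable_continuous; apply/derivable1_diffP.
by rewrite -(subrK 1 x); apply: ex_derive; exact: is_derive_gamma_fun.
Qed.

Lemma gamma_fun_cvg0 (x : R) : 0 < x -> gamma_fun (x + 1) t @[t --> 0^'+] --> 0.
Proof.
move=> x0; rewrite -[X in _ --> X](mul0r (expR (- (0:R)))).
apply: cvgM; first by rewrite addrK; exact: powR_cvg0.
apply: cvg_at_right_filter; apply: continuous_comp; first exact: opp_continuous.
exact: continuous_expR.
Qed.

(** Since [t / (2 x) <= expR (t / (2 x))], the power [t ^ x] is at most
    [(2 x) ^ x * expR (t / 2)], which leaves a factor [expR (- (t / 2))]. *)
Lemma gamma_fun_cvgy (x : R) : 0 < x -> gamma_fun (x + 1) t @[t --> +oo] --> 0.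
Proof.
move=> x0.
have x2 : 0 < 2 * x by lra.
apply: (@squeeze_cvgr _ _ _ _ (cst 0) (fun t => (2 * x) `^ x * expR (- (t / 2)))).
- near=> t; rewrite gamma_fun_ge0 /=.
  have t0 : 0 < t by near: t; exact: nbhs_pinfty_gt.
  rewrite /gamma_fun addrK.
  have -> : expR (- t) = expR (- (t / 2)) * expR (- (t / 2)).
    by rewrite -expRD; congr expR; lra.
  rewrite mulrA ler_wpM2r ?expR_ge0// expRN ler_pdivrMr ?expR_gt0//.
  have -> : expR (t / 2) = expR (t / (2 * x)) `^ x.
    by rewrite -expRM; congr expR; field; rewrite gt_eqF.
  rewrite -powRM ?expR_ge0 ?(ltW x2)//.
  apply: (ge0_ler_powR (ltW x0)); rewrite ?nnegrE ?(ltW t0) ?mulr_ge0 ?(ltW x0) ?expR_ge0//.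
  rewrite -ler_pdivrMl// [leLHS]mulrC.
  by apply: le_trans (expR_ge1Dx _); rewrite lerDr.
- exact: cvg_cst.
- rewrite -(mulr0 ((2 * x) `^ x)); apply: cvgMr.
  apply: (cvg_comp (fun t => t / 2) (fun t => expR (- t))); last exact: cvgr_expR.
  by apply: gt0_cvgMly; [rewrite invr_gt0|exact: cvg_id].
Unshelve. all: by end_near. Qed.

Lemma harmonic_nonincreasing : nonincreasing_seq (@harmonic R).
Proof. by move=> m n mn; rewrite /harmonic/= lef_pV2 ?posrE// ler_nat. Qed.

Lemma natS_nondecreasing : nondecreasing_seq (fun n => n.+1%:R : R).
Proof. by move=> m n mn; rewrite ler_nat. Qed.

Lemma natS_cvgy : (n.+1%:R : R) @[n --> \oo] --> +oo.
Proof.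
have h := @cvgr_idn R.
by rewrite -(cvg_shiftS (fun n => n%:R : R)) in h.
Qed.

Lemma harmonic_cvg0_right : @harmonic R @ \oo --> (0 : R)^'+.
Proof.
move=> A [e /= e0 eA].
have /cvgrPdistC_lt/(_ _ e0)[N _ NA] := @cvg_harmonic R.
exists N => // n /NA/= h; apply: eA; last by rewrite /harmonic/= invr_gt0.
by rewrite /ball_/= distrC.
Qed.

(** Integration by parts on a compact interval: the derivative of
    [t ^ x * expR (- t)] is the difference of the two integrands. *)
Lemma integral_gamma_funS x (a b : R) : 0 < a -> a < b ->
  (x%:E * \int[mu]_(t in `[a, b]) (gamma_fun x t)%:E =
   \int[mu]_(t in `[a, b]) (gamma_fun (x + 1) t)%:E +
   (gamma_fun (x + 1) b - gamma_fun (x + 1) a)%:E)%E.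
Proof.
move=> a0 ab.
have pos t : t \in `[a, b] -> 0 < t.
  by rewrite in_itv/= => /andP[at_ _]; exact: lt_le_trans at_.
have cont y : {within `[a, b], continuous (gamma_fun y)}.
  apply: continuous_in_subspaceT => t; rewrite inE/= => tab.
  exact/continuous_gamma_fun/pos.
have int y : mu.-integrable `[a, b] (EFin \o gamma_fun y).
  apply: continuous_compact_integrable; last exact: cont.
  exact: segment_compact.
have ftc := @continuous_FTC2 R (fun t => x * gamma_fun x t - gamma_fun (x + 1) t)
  (gamma_fun (x + 1)) a b ab.
rewrite EFinB -ftc; last first.
- move=> t /subset_itv_oo_cc /pos t0.
  rewrite derive1E.
  by have [_ ->] := is_derive_gamma_fun x t0.
- split.
  + move=> t /subset_itv_oo_cc /pos t0.
    by apply: ex_derive; exact: is_derive_gamma_fun.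
  + apply: cvg_at_right_filter; exact: continuous_gamma_fun.
  + apply: cvg_at_left_filter; apply: continuous_gamma_fun; exact: lt_trans ab.
- move=> t; apply: cvgB; last exact: cont.
  by apply: cvgM; [exact: cvg_cst|exact: cont].
under [X in _ = (_ + X)%E]eq_integral do rewrite EFinB EFinM.
rewrite integralB//=; last 2 first.
  exact: integrableZl (int x).
  exact: int (x + 1).
rewrite integralZl//; last exact: int.
rewrite addeC subeK//.
exact: (integrable_fin_num _ (int (x + 1))).
Qed.

Lemma eGammaS x : 0 < x -> eGamma (x + 1) = (x%:E * eGamma x)%E.
Proof.
move=> x0.
have ex y := cvg_integral_exhaust (fun n => harmonic_gt0 n)
  harmonic_nonincreasing cvg_harmonic natS_nondecreasing natS_cvgy
  (measurable_EFin_gamma_fun y) (fun t _ => gamma_fun_ge0 y t).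
have lx := cvgeZl (isT : x%:E \is a fin_num) (ex x).
have bdry : (gamma_fun (x + 1) n.+1%:R - gamma_fun (x + 1) (harmonic n))%:E
    @[n --> \oo] --> (0 : \bar R).
  apply: cvg_EFin; first exact: nearW.
  rewrite -[X in _ --> X](subrr (0 : R)); apply: cvgB.
    exact: (cvg_comp _ _ natS_cvgy (gamma_fun_cvgy x0)).
  exact: (cvg_comp _ _ harmonic_cvg0_right (gamma_fun_cvg0 x0)).
have lS := cvgeD (fin_num_adde_defl _ (isT : (0 : \bar R) \is a fin_num))
  (ex (x + 1)) bdry.
rewrite adde0 in lS; have {}lS := lS (@filter_filter _ _ eventually_filter).
apply: (cvg_unique (@ereal_hausdorff R) lS).
apply: cvg_trans lx; apply: near_eq_cvg; near=> n.
have n0 : (0 < n)%N by near: n; exact: nbhs_infty_gt.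
rewrite /= integral_gamma_funS ?invr_gt0// /harmonic/=.
by rewrite (@lt_le_trans _ _ 1) ?invf_lt1 ?ltr1n ?ler1n.
Unshelve. all: by end_near. Qed.

(** Weighted arithmetic-geometric mean inequality: write [s = expR y], factor
    out [expR (r * y)] and use [1 + z <= expR z] at [(1 - r) * y] and
    [- (r * y)]. *)
Lemma powR_le_affine (s r : R) : 0 < s -> 0 <= r <= 1 ->
  s `^ r <= 1 - r + r * s.
Proof.
move=> s0 /andP[r0 r1]; rewrite /powR gt_eqF//.
set y := ln s.
have sE : s = expR (r * y) * expR ((1 - r) * y).
  by rewrite -expRD -[LHS](lnK s0); congr expR; rewrite /y; ring.
have h1 := expR_ge1Dx ((1 - r) * y).
have h2 := expR_ge1Dx (- (r * y)).
have e0 := expR_gt0 (r * y).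
have e1 : expR (r * y) * expR (- (r * y)) = 1 by rewrite -expRD subrr expR0.
rewrite {}sE -subr_ge0.
rewrite [leRHS](_ : _ = expR (r * y) * ((1 - r) * (expR (- (r * y)) - (1 - r * y))
    + r * (expR ((1 - r) * y) - (1 + (1 - r) * y)))).
  by rewrite mulr_ge0 ?addr_ge0 ?mulr_ge0 ?subr_ge0 ?(ltW e0).
by ring: e1.
Qed.

(** The previous inequality at [t / x]; this scaling makes both terms contribute
    multiples of [x ^ r * Gamma x] after integration. *)
Lemma gamma_funD_le x r t : 0 < x -> 0 <= r <= 1 -> 0 < t ->
  gamma_fun (x + r) t <= (x `^ r * (1 - r)) * gamma_fun x t
    + (x `^ r * r / x) * gamma_fun (x + 1) t.
Proof.
move=> x0 r01 t0; rewrite gamma_funS//.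
have -> : gamma_fun (x + r) t = t `^ r * gamma_fun x t.
  rewrite /gamma_fun mulrA; congr (_ * _).
  by rewrite -powRD ?(gt_eqF t0) ?implybT//; congr (_ `^ _); ring.
rewrite (mulrA _ t) -mulrDl ler_wpM2r ?gamma_fun_ge0//.
have -> : t `^ r = x `^ r * (t / x) `^ r.
  by rewrite -powRM ?divr_ge0 ?ltW//; congr (_ `^ _); field; rewrite gt_eqF.
have -> : x `^ r * (1 - r) + x `^ r * r / x * t = x `^ r * (1 - r + r * (t / x)).
  by field; rewrite gt_eqF.
by rewrite ler_wpM2l ?powR_ge0// powR_le_affine// divr_gt0.
Qed.

(** After integration the weights [1 - r] and [r] recombine, because
    [Gamma (x + 1) / x = Gamma x].  The bound plays the part of the
    logarithmic convexity of Gamma. *)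
Lemma eGammaD_le x r : 0 < x -> 0 <= r <= 1 ->
  (eGamma (x + r) <= (x `^ r)%:E * eGamma x)%E.
Proof.
move=> x0 /[dup] r01 /andP[r0 r1].
have c1 : 0 <= x `^ r * (1 - r) by rewrite mulr_ge0 ?powR_ge0// subr_ge0.
have c2 : 0 <= x `^ r * r / x by rewrite divr_ge0 ?mulr_ge0 ?powR_ge0// ltW.
have mZ c y : measurable_fun [set: R] (fun t => (c%:E * (gamma_fun y t)%:E)%E).
  apply/measurable_EFinP; apply: measurable_funM => //.
  exact: measurable_gamma_fun.
have pZ c y : 0 <= c -> forall t, (0 <= c%:E * (gamma_fun y t)%:E)%E.
  by move=> c0 t; rewrite -EFinM lee_fin mulr_ge0 ?gamma_fun_ge0.
apply: (@le_trans _ _ (\int[mu]_(t in `]0%R, +oo[)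
   ((x `^ r * (1 - r))%:E * (gamma_fun x t)%:E
    + (x `^ r * r / x)%:E * (gamma_fun (x + 1) t)%:E))%E).
  apply: ge0_le_integral => //.
  - by move=> t _; rewrite lee_fin gamma_fun_ge0.
  - by apply: measurable_funTS; exact: measurable_EFin_gamma_fun.
  - by apply: measurable_funTS; apply: emeasurable_funD; exact: mZ.
  - move=> t /=; rewrite in_itv/= andbT => t0.
    by rewrite -!EFinM -EFinD lee_fin gamma_funD_le.
rewrite ge0_integralD//; last 4 first.
- by move=> t _; exact: pZ.
- by apply: measurable_funTS; exact: mZ.
- by move=> t _; exact: pZ.
- by apply: measurable_funTS; exact: mZ.
rewrite !ge0_integralZl_EFin//; last 4 first.
- by move=> t _; rewrite lee_fin gamma_fun_ge0.
- by apply: measurable_funTS; exact: measurable_EFin_gamma_fun.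
- by move=> t _; rewrite lee_fin gamma_fun_ge0.
- by apply: measurable_funTS; exact: measurable_EFin_gamma_fun.
rewrite -!/(eGamma _) eGammaS// muleA -EFinM divfK ?gt_eqF//.
by rewrite -ge0_muleDl ?lee_fin ?mulr_ge0 ?powR_ge0 ?subr_ge0// -EFinD -mulrDr subrK mulr1.
Qed.

Lemma eGamma1 : eGamma 1 = 1%E.
Proof.
rewrite /eGamma integral_itv_obnd_cbnd; last first.
  by apply: measurable_funTS; exact: measurable_EFin_gamma_fun.
under eq_integral do rewrite /gamma_fun subrr powRr0 mul1r.
rewrite (@ge0_continuous_FTC2y R (fun t => expR (- t)) (fun t => - expR (- t)) 0 0).
- by rewrite oppr0 expR0 sub0e EFinN oppeK.
- by move=> t _; exact: expR_ge0.
- apply: continuous_subspaceT => t.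
  by apply: continuous_comp; [exact: opp_continuous|exact: continuous_expR].
- by rewrite -oppr0; apply: cvgN; exact: cvgr_expR.
- by move=> t _; apply: ex_derive.
- apply: cvg_at_right_filter; apply: cvgN.
  by apply: continuous_comp; [exact: opp_continuous|exact: continuous_expR].
- move=> t _; rewrite derive1E derive_val.
  by rewrite /GRing.scale/= mulrN1 opprK.
Qed.

(** The substitution [t = u ^ 2]. *)
Lemma integral_gamma_fun_half (a b : R) : 0 < a -> a <= b ->
  (\int[mu]_(t in `[(a ^+ 2)%R, (b ^+ 2)%R]) (gamma_fun 2^-1 t)%:E =
   \int[mu]_(u in `[a, b]) (2%:E * (gauss_fun u)%:E))%E.
Proof.
move=> a0 ab.
have dsqr (u : R) : is_derive u 1 (fun u : R => u ^+ 2) (2 * u).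
  apply: is_derive_eq; rewrite /GRing.scale/=; ring.
have sqrE : (fun u : R => u ^+ 2)^`()%classic = (fun u => 2 * u).
  by apply/funext => u; rewrite derive1E; have [_ ->] := dsqr u.
have clin (u : R) : {for u, continuous (fun u : R => 2 * u)}.
  by apply: cvgM; [exact: cvg_cst|exact: cvg_id].
have csqr (u : R) : {for u, continuous (fun u : R => u ^+ 2)}.
  by apply: differentiable_continuous; apply/derivable1_diffP; apply: ex_derive; exact: dsqr.
rewrite (@integration_by_substitution_increasing R (fun u => u ^+ 2)
  (gamma_fun 2^-1) a b ab); first last.
- apply: continuous_in_subspaceT => t; rewrite inE/= in_itv/= => /andP[at_ _].
  by apply: continuous_gamma_fun; rewrite (lt_le_trans _ at_)// exprn_gt0.
- split.
  + by move=> u _; apply: ex_derive; exact: dsqr.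
  + by apply: cvg_at_right_filter; exact: csqr.
  + by apply: cvg_at_left_filter; exact: csqr.
- by rewrite sqrE; apply/cvg_ex; exists (2 * b); apply: cvg_at_left_filter; exact: clin.
- by rewrite sqrE; apply/cvg_ex; exists (2 * a); apply: cvg_at_right_filter; exact: clin.
- by move=> u _; rewrite sqrE; exact: clin.
- move=> u v; rewrite !in_itv/= => /andP[au _] /andP[av _] uv.
  by rewrite ltr_pXn2r// nnegrE ltW// (lt_le_trans a0).
apply: eq_integral => u; rewrite inE/= in_itv/= => /andP[au _].
have u0 : 0 < u by exact: lt_le_trans au.
rewrite sqrE /gamma_fun /gauss_fun/= -EFinM; congr (_%:E).
rewrite [LHS](_ : _ = (u ^+ 2) `^ (2^-1 - 1) * expR (- u ^+ 2) * (2 * u))//.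
rewrite (_ : (u ^+ 2) `^ (2^-1 - 1) = u^-1); first by field; rewrite gt_eqF.
rewrite -powR_mulrn ?ltW// -powRrM -(@powR_inv1 _ u) ?ltW//.
by congr (_ `^ _); field.
Qed.

Lemma eGamma_half : eGamma (2^-1) = (Num.sqrt pi)%:E.
Proof.
have mg : measurable_fun [set: R] (fun u => (2%:E * (gauss_fun u)%:E)%E).
  apply/measurable_EFinP; apply: measurable_funM => //.
  exact: measurable_gauss_fun.
have ex1 := cvg_integral_exhaust (fun n => harmonic_gt0 n)
  harmonic_nonincreasing cvg_harmonic natS_nondecreasing natS_cvgy.
have pg (t : R) (_ : 0 < t) : (0 <= 2%:E * (gauss_fun t)%:E)%E.
  by rewrite -EFinM lee_fin mulr_ge0 ?gauss_fun_ge0.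
have {pg}ex1 := ex1 _ mg pg.
have ex2 : (\int[mu]_(t in `[(harmonic n ^+ 2)%R, (n.+1%:R ^+ 2)%R])
    (gamma_fun 2^-1 t)%:E)%E @[n --> \oo] --> eGamma 2^-1.
  apply: cvg_integral_exhaust.
  - by move=> n; rewrite exprn_gt0// harmonic_gt0.
  - move=> m n mn; rewrite ler_sqr ?nnegrE ?harmonic_ge0//.
    exact: harmonic_nonincreasing.
  - by rewrite -(mul0r (0 : R)); apply: cvgM; exact: cvg_harmonic.
  - move=> m n mn; rewrite ler_sqr ?nnegrE//.
    exact: natS_nondecreasing.
  - exact: (cvg_comp _ _ natS_cvgy cvgr_expr2).
  - exact: measurable_EFin_gamma_fun.
  - by move=> t _; rewrite lee_fin gamma_fun_ge0.
apply: (cvg_unique (@ereal_hausdorff R) ex2).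
have <- : (\int[mu]_(t in `]0%R, +oo[) (2%:E * (gauss_fun t)%:E))%E
    = (Num.sqrt pi)%:E :> \bar R.
  rewrite ge0_integralZl_EFin//; last 2 first.
  - by move=> t _; rewrite lee_fin gauss_fun_ge0.
  - by apply/measurable_EFinP/measurable_funTS; exact: measurable_gauss_fun.
  rewrite integral_itv_obnd_cbnd; last first.
    by apply/measurable_EFinP/measurable_funTS; exact: measurable_gauss_fun.
  by rewrite integral0y_gauss -EFinM mulrC divfK.
apply: cvg_trans ex1; apply: near_eq_cvg; near=> n.
rewrite integral_gamma_fun_half// ?harmonic_gt0// /harmonic/=.
by rewrite (@le_trans _ _ 1) ?invf_le1 ?ler1n.
Unshelve. all: by end_near. Qed.

Lemma eGamma_fin_num x : 0 < x -> eGamma x \is a fin_num.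
Proof.
(* the functional equation covers the integers; a real [y >= 1] is bounded by
   means of its integer part, and [x < 1] is reached from [x + 1] *)
have step (y : R) : 1 <= y -> eGamma y \is a fin_num.
  have atn n : (eGamma n.+1%:R) \is a fin_num.
    elim: n => [|n IH]; first by rewrite eGamma1.
    by rewrite -natr1 eGammaS ?fin_numM.
  move=> y1; have y0 : 0 <= y by lra.
  have /andP[ny yn] := truncn_itv y0.
  set n := Num.truncn y in ny yn.
  have n1 : (0 < n)%N by rewrite truncn_gt0.
  rewrite ge0_fin_numE ?eGamma_ge0//.
  have -> : eGamma y = eGamma (n%:R + (y - n%:R)) by rewrite addrC subrK.
  have yn1 : 0 <= y - n%:R <= 1 by move: yn; rewrite -natr1; lra.
  have n0 : 0 < n%:R :> R by rewrite ltr0n.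
  apply: (le_lt_trans (eGammaD_le n0 yn1)).
  rewrite -ge0_fin_numE ?mule_ge0 ?lee_fin ?powR_ge0 ?eGamma_ge0// fin_numM//.
  by case: (n) n1 => // m _; exact: atn.
move=> x0.
have : eGamma (x + 1) \is a fin_num by apply: step; lra.
by rewrite eGammaS//; case: (eGamma x) => // ; rewrite ?gt0_muley ?gt0_muleNy ?lte_fin.
Qed.

Lemma eGamma_EFin x : 0 < x -> eGamma x = (Gamma x)%:E.
Proof. by move=> x0; rewrite GammaE fineK// eGamma_fin_num. Qed.

Lemma GammaS x : 0 < x -> Gamma (x + 1) = x * Gamma x.
Proof.
move=> x0; have x1 : 0 < x + 1 by rewrite addr_gt0.
by apply: EFin_inj; rewrite EFinM -!eGamma_EFin ?eGammaS.
Qed.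

Lemma Gamma1 : Gamma (1 : R) = 1.
Proof. by rewrite GammaE eGamma1. Qed.

Lemma Gamma_half : Gamma (2^-1 : R) = Num.sqrt pi.
Proof. by rewrite GammaE eGamma_half. Qed.

Lemma GammaD_le x r : 0 < x -> 0 <= r <= 1 ->
  Gamma (x + r) <= x `^ r * Gamma x.
Proof.
move=> x0 r01; have xr : 0 < x + r by case/andP: r01 => r0 _; rewrite ltr_wpDr.
by rewrite -lee_fin EFinM -!eGamma_EFin ?eGammaD_le.
Qed.

Lemma Gamma_gt0 x : 0 < x -> 0 < Gamma x.
Proof.
have atn n : 0 < Gamma (n.+1%:R : R).
  elim: n => [|n IH]; first by rewrite Gamma1.
  by rewrite -natr1 GammaS ?mulr_gt0.
have step (y : R) : 1 <= y -> 0 < Gamma y.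
  move=> y1; have y0 : 0 <= y by lra.
  have /andP[ny yn] := truncn_itv y0.
  set n := Num.truncn y in ny yn.
  have y0' : 0 < y by lra.
  have yn1 : 0 <= n.+1%:R - y <= 1.
    by move: yn; rewrite -natr1; lra.
  have := GammaD_le y0' yn1; rewrite addrC subrK => h.
  by rewrite -(pmulr_rgt0 _ (powR_gt0 (n.+1%:R - y) y0')) (lt_le_trans (atn n)).
move=> x0; rewrite -(pmulr_rgt0 _ x0) -GammaS//; apply: step; lra.
Qed.

(** Legendre's duplication formula at the integers, by induction from
    [Gamma (1/2) = sqrt pi]. *)
Lemma Gamma_double n : Gamma (2 * n%:R + 1 : R) * Num.sqrt pi =
  4 ^+ n * Gamma (n%:R + 1) * Gamma (n%:R + 2^-1).
Proof.
have p m : [/\ 0 < m%:R + 1 :> R, 0 < m%:R + 2^-1 :> R,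
    0 < 2 * m%:R + 1 :> R & 0 < 2 * m%:R + 1 + 1 :> R].
  by have : 0 <= m%:R :> R by []; split; lra.
elim: n => [|n IH].
  by rewrite mulr0 !add0r Gamma1 Gamma_half expr0 !mul1r.
rewrite -(natr1 n).
rewrite (_ : 2 * (n%:R + 1) + 1 = (2 * n%:R + 1) + 1 + 1 :> R); last by ring.
rewrite (_ : n%:R + 1 + 2^-1 = n%:R + 2^-1 + 1 :> R); last by ring.
have [n1 nh d1 d2] := p n.
rewrite (GammaS n1) (GammaS nh) (GammaS d2) (GammaS d1) exprS.
set P := Num.sqrt pi in IH *; rewrite -[LHS]mulrA -[_ * Gamma _ * _]mulrA IH.
by move: (Gamma _) (Gamma _) (4 ^+ n) => A B C; field.
Qed.

End gamma.

(** * Inequalities for the logarithm *)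

Section logarithm.
Local Open Scope classical_set_scope.
Local Open Scope ring_scope.
Context {R : realType}.
Implicit Types a b u x : R.

Lemma lnB_le a b : 0 < a -> 0 < b -> ln b - ln a <= (b - a) / a.
Proof.
move=> a0 b0; rewrite -ln_div ?posrE//.
have -> : b / a = 1 + (b - a) / a by field; rewrite gt_eqF.
apply: le_ln1Dx.
have : 0 < b / a by rewrite divr_gt0.
by rewrite mulrBl divff ?gt_eqF//; lra.
Qed.

(** The derivative is passed as a function, so that users only have to supply
    its closed form. *)
Lemma derive_ge0_le (f f' : R -> R) u : 0 <= u ->
  (forall t, 0 <= t <= u -> is_derive t 1 f (f' t)) ->
  (forall t, 0 < t < u -> 0 <= f' t) -> f 0 <= f u.
Proof.
move=> u0 df f'0.
have sub t : t \in `]0, u[ -> 0 <= t <= u.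
  by rewrite in_itv/= => /andP[/ltW-> /ltW->].
apply: (@ger0_derive1_ndecr R f 0 u) => //.
- by move=> t /sub /df dt; apply: ex_derive.
- move=> t tu; rewrite derive1E.
  have [_ ->] := df _ (sub _ tu).
  by apply: f'0; move: tu; rewrite in_itv.
- apply: continuous_in_subspaceT => t; rewrite inE/= in_itv/= => tu.
  by apply: differentiable_continuous; apply/derivable1_diffP; have := df _ tu.
Qed.

Lemma is_derive_artanh u : 0 <= u < 1 ->
  is_derive u 1 (fun t => ln (1 + t) - ln (1 - t)) (2 / (1 - u ^+ 2)).
Proof.
move=> /andP[u0 u1].
have p0 : 0 < 1 + u by lra.
have m0 : 0 < 1 - u by lra.
have hp := is_derive1_ln p0.
have hm := is_derive1_ln m0.
have dp : is_derive u 1 (fun t => ln (1 + t)) (1 + u)^-1.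
  have h := @is_derive1_comp R (@ln R) (fun t => 1 + t) u _ _ hp _.
  apply: is_derive_eq; ring.
have dm : is_derive u 1 (fun t => ln (1 - t)) (- (1 - u)^-1).
  have h := @is_derive1_comp R (@ln R) (fun t => 1 - t) u _ _ hm _.
  apply: is_derive_eq; ring.
apply: is_derive_eq; field.
by rewrite !gt_eqF//; nra.
Qed.

(** Twice the first two terms of the power series of the inverse hyperbolic
    tangent; the derivative of the difference is [2 / (1 - t^2) - 2 - 2 t^2]. *)
Lemma artanh_ge u : 0 <= u < 1 ->
  2 * u + 2 / 3 * u ^+ 3 <= ln (1 + u) - ln (1 - u).
Proof.
move=> /andP[u0 u1]; rewrite -subr_ge0.
pose f t := (ln (1 + t) - ln (1 - t)) - (2 * t + 2 / 3 * t ^+ 3) : R.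
suff: f 0 <= f u by rewrite {1}/f addr0 subr0 ln1 expr0n/= !(mulr0, mul0r, addr0, subr0).
apply: (@derive_ge0_le f (fun t => 2 / (1 - t ^+ 2) - (2 + 2 * t ^+ 2))) => //.
- move=> t /andP[t0 tu].
  have t1 : 0 <= t < 1 by rewrite t0/= (le_lt_trans tu).
  have := is_derive_artanh t1 => d.
  apply: is_derive_eq; rewrite /GRing.scale/=; field.
  by rewrite gt_eqF//; move: t1; nra.
- move=> t /andP[t0 tu]; have t1 : t < 1 by exact: lt_trans u1.
  have d0 : 0 < 1 - t ^+ 2 by nra.
  rewrite subr_ge0 ler_pdivlMr//; nra.
Qed.

(** In the power series the coefficients [1/5, 1/7, ...] are replaced by [1/3],
    which leaves a geometric series; the derivative of the difference is
    [(4/3) t^4 / (1 - t^2)^2]. *)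
Lemma artanh_le u : 0 <= u < 1 ->
  ln (1 + u) - ln (1 - u) <= 2 * u + 2 / 3 * (u ^+ 3 / (1 - u ^+ 2)).
Proof.
move=> /andP[u0 u1]; rewrite -subr_ge0.
pose f t := (2 * t + 2 / 3 * (t ^+ 3 / (1 - t ^+ 2))) - (ln (1 + t) - ln (1 - t)) : R.
suff: f 0 <= f u by rewrite {1}/f addr0 subr0 ln1 expr0n/= !(mulr0, mul0r, addr0, subr0).
apply: (@derive_ge0_le f
  (fun t => 4 / 3 * (t ^+ 4 / (1 - t ^+ 2) ^+ 2))).
- exact: u0.
- move=> t /andP[t0 tu].
  have t1 : 0 <= t < 1 by rewrite t0/= (le_lt_trans tu).
  have d0 : 1 - t ^+ 2 != 0 by rewrite gt_eqF//; move: t1; nra.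
  have := is_derive_artanh t1 => d.
  have dV : is_derive t 1 (fun t => (1 - t ^+ 2)^-1)
     (- (1 - t ^+ 2) ^- 2 *: (- (2 * t))).
    apply: is_deriveV => //.
    by apply: is_derive_eq; rewrite /GRing.scale/=; ring.
  by apply: is_derive_eq; rewrite /GRing.scale/=; field.
- move=> t /andP[t0 tu].
  have : 0 <= t ^+ 4 / (1 - t ^+ 2) ^+ 2.
    by rewrite divr_ge0 ?sqr_ge0// exprn_ge0// ltW.
  by apply: mulr_ge0; rewrite divr_ge0.
Qed.

End logarithm.

(** * The logarithm of the Stirling quotient *)

Section stirling.
Local Open Scope classical_set_scope.
Local Open Scope ring_scope.
Context {R : realType}.
Implicit Types a b c u x r : R.

Definition stirling_log x : R := ln (Pi x / S_ 0 x).

Lemma Pi_gt0 x : 0 < x + 1 -> 0 < Pi x.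
Proof. exact: Gamma_gt0. Qed.

Lemma sqrt2pi_gt0 : 0 < Num.sqrt (2 * pi) :> R.
Proof. by rewrite sqrtr_gt0 mulr_gt0 ?pi_gt0. Qed.

Lemma S0_gt0 x : 0 < x -> 0 < S_ 0 x.
Proof.
move=> x0; rewrite /S_ !mulr_gt0 ?expR_gt0 ?sqrt2pi_gt0//.
by rewrite powR_gt0// addr0.
Qed.

Lemma ln_sqrt c : 0 <= c -> ln (Num.sqrt c) = 2^-1 * ln c.
Proof. by move=> c0; rewrite -powR12_sqrt// ln_powR. Qed.

Lemma stirling_logE x : 0 < x -> stirling_log x =
  ln (Gamma (x + 1)) - (x + 2^-1) * ln x + x - 2^-1 * (ln 2 + ln pi).
Proof.
move=> x0; rewrite /stirling_log ln_div ?posrE ?S0_gt0 ?Pi_gt0 ?ltr_wpDr ?ler01//.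
rewrite /S_ oppr0 expR0 mulr1 addr0.
rewrite !lnM ?posrE ?mulr_gt0 ?sqrt2pi_gt0 ?powR_gt0 ?expR_gt0//.
rewrite expRK ln_powR ln_sqrt ?mulr_ge0 ?pi_ge0//.
by rewrite lnM ?posrE ?pi_gt0// /Pi; ring.
Qed.

Lemma stirling_ratioE x : 0 < x -> Pi x / S_ 0 x = expR (stirling_log x).
Proof.
move=> x0; rewrite /stirling_log lnK// posrE divr_gt0 ?S0_gt0 ?Pi_gt0//.
by rewrite ltr_wpDr.
Qed.

(** Passing from the left to the right multiplies numerator and denominator
    by [x + 1]. *)
Lemma stirling_ratio1E x : 0 <= x -> Pi x / S_ 1 x = Pi (x + 1) / S_ 0 (x + 1).
Proof.
move=> x0; have x1 : 0 < x + 1 by lra.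
rewrite /Pi (GammaS x1) /S_ oppr0 expR0 mulr1 addr0.
rewrite (_ : x + 1 + 2^-1 = 1 + (x + 2^-1)); last by ring.
rewrite (@powRD _ _ 1) ?(gt_eqF x1) ?implybT// powRr1 ?ltW//.
rewrite (_ : expR (- (x + 1)) = expR (- 1) * expR (- x)); last first.
  by rewrite -expRD; congr expR; ring.
field.
by rewrite !gt_eqF// ?expR_gt0 ?sqrt2pi_gt0 ?powR_gt0.
Qed.

Lemma stirling_log_diff x : 0 < x ->
  stirling_log x - stirling_log (x + 1) = (x + 2^-1) * (ln (x + 1) - ln x) - 1.
Proof.
move=> x0; have x1 : 0 < x + 1 by lra.
rewrite !stirling_logE// [in X in _ - X]GammaS// lnM ?posrE ?Gamma_gt0//.
by field.
Qed.

Lemma ln_succ_artanh x : 0 < x ->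
  ln (x + 1) - ln x = ln (1 + (2 * x + 1)^-1) - ln (1 - (2 * x + 1)^-1).
Proof.
move=> x0.
have y0 : 0 < 2 * x + 1 by lra.
have -> : 1 + (2 * x + 1)^-1 = 2 * (x + 1) / (2 * x + 1).
  by field; rewrite gt_eqF.
have -> : 1 - (2 * x + 1)^-1 = 2 * x / (2 * x + 1).
  by field; rewrite gt_eqF.
have x1 : 0 < x + 1 by lra.
by rewrite !ln_div ?posrE ?mulr_gt0// !lnM ?posrE//; ring.
Qed.

Lemma stirling_log_diff_ge x : 0 < x ->
  1 / (3 * (2 * x + 1) ^+ 2) <= stirling_log x - stirling_log (x + 1).
Proof.
move=> x0; rewrite stirling_log_diff// ln_succ_artanh//.
have y0 : 0 < 2 * x + 1 by lra.
have u01 : 0 <= (2 * x + 1)^-1 < 1 by rewrite invr_ge0 invf_lt1//; lra.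
have x12 : 0 <= x + 2^-1 by lra.
rewrite lerBrDr; apply: le_trans (ler_wpM2l x12 (artanh_ge u01)).
by rewrite le_eqVlt; apply/orP; left; apply/eqP; field; rewrite gt_eqF.
Qed.

Lemma stirling_log_diff_le x : 0 < x ->
  stirling_log x - stirling_log (x + 1) <= 1 / (12 * x) - 1 / (12 * (x + 1)).
Proof.
move=> x0; rewrite stirling_log_diff// ln_succ_artanh//.
have y0 : 0 < 2 * x + 1 by lra.
have u01 : 0 <= (2 * x + 1)^-1 < 1 by rewrite invr_ge0 invf_lt1//; lra.
have x12 : 0 <= x + 2^-1 by lra.
rewrite lerBlDr; apply: le_trans (ler_wpM2l x12 (artanh_le u01)) _.
rewrite le_eqVlt; apply/orP; left; apply/eqP; field.
rewrite !gt_eqF//; nra.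
Qed.

(** [GammaD_le] at [x + 1] bounds the factorial part, and tangent bounds for [ln]
    the elementary part.  The error vanishes at infinity, so that limits along
    [x + n] and [x + r + n] can be compared. *)
Lemma stirling_log_step x r : 0 < x -> 0 <= r <= 1 ->
  stirling_log (x + r) <= stirling_log x + 2 / x.
Proof.
move=> x0 /andP[r0 r1].
have xr : 0 < x + r by lra.
have x1 : 0 < x + 1 by lra.
have x12 : 0 <= x + 2^-1 by lra.
have e : r * ((x + 1 - (x + r)) / (x + r)) + (x + 2^-1) * ((x - (x + r)) / (x + r))
   + r <= 2 / x.
  rewrite [leLHS](_ : _ = (r / 2) / (x + r)); last by field; rewrite gt_eqF.
  apply: (@le_trans _ _ (2 / (x + r))).
    by rewrite ler_pM2r ?invr_gt0//; lra.
  by rewrite ler_pM2l// lef_pV2 ?posrE// lerDl.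
have h1 := ler_wpM2l r0 (lnB_le xr x1).
have h2 := ler_wpM2l x12 (lnB_le xr x0).
have hG : ln (Gamma (x + r + 1)) <= r * ln (x + 1) + ln (Gamma (x + 1)).
  rewrite addrAC -ln_powR -lnM ?posrE ?powR_gt0 ?Gamma_gt0//.
  rewrite ler_ln ?posrE ?mulr_gt0 ?powR_gt0 ?Gamma_gt0 ?ltr_wpDr//.
  by apply: GammaD_le => //; rewrite r0.
rewrite !stirling_logE// -subr_ge0.
have := lerD (lerD e hG) (lerD h1 h2); rewrite -subr_ge0.
by congr (0 <= _); ring.
Qed.

Lemma cvg_affine_inv a b c : 0 < b -> a / (b * n%:R + c) @[n --> \oo] --> (0 : R).
Proof.
move=> b0; rewrite -[X in _ --> X](mulr0 a); apply: cvgMr.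
apply/gtr0_cvgV0; last first.
  apply/cvgryPge => A; near=> n.
  rewrite -lerBlDr -ler_pdivrMl//.
  by near: n; exact: nbhs_infty_ger.
near=> n.
rewrite -ltrBlDr sub0r -ltr_pdivrMl//.
by near: n; exact: nbhs_infty_gtr.
Unshelve. all: by end_near. Qed.

(** [v - u] is nonincreasing with limit [0], hence nonnegative: this sums the
    decrements without mentioning series. *)
Lemma ler_of_decrements (u v : R^nat) :
  (forall n, u n - u n.+1 <= v n - v n.+1) ->
  u @ \oo --> (0 : R) -> v @ \oo --> (0 : R) -> u 0%N <= v 0%N.
Proof.
move=> uv u0 v0; rewrite -subr_ge0.
have w0 : v n - u n @[n --> \oo] --> (0 : R).
  by rewrite -[X in _ --> X](subrr (0 : R)); exact: cvgB.
have wdec : nonincreasing_seq (fun n => v n - u n).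
  by apply/nonincreasing_seqP => n; have := uv n; lra.
have := nonincreasing_cvgn_ge wdec (cvgP _ w0) 0%N.
by rewrite (cvg_lim _ w0).
Qed.

Lemma stirling_log_nonincreasing x : 0 < x ->
  nonincreasing_seq (fun n => stirling_log (x + n%:R)).
Proof.
move=> x0; apply/nonincreasing_seqP => n; rewrite -natr1 addrA -subr_ge0.
have xn : 0 < x + n%:R by rewrite ltr_wpDr.
apply: le_trans (stirling_log_diff_ge xn).
by rewrite divr_ge0// mulr_ge0// sqr_ge0.
Qed.

(** The sequence is nonincreasing, and it is bounded below because subtracting
    [1 / (12 (x + n))] makes it nondecreasing. *)
Lemma is_cvg_stirling_log x : 0 < x ->
  cvgn (fun n => stirling_log (x + n%:R)).
Proof.
move=> x0; apply: nonincreasing_is_cvgn; first exact: stirling_log_nonincreasing.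
exists (stirling_log x - 1 / (12 * x)) => _ [n _ <-].
have : nondecreasing_seq
    (fun n => stirling_log (x + n%:R) - 1 / (12 * (x + n%:R))).
  apply/nondecreasing_seqP => {}n; rewrite -(natr1 n) addrA.
  have xn : 0 < x + n%:R by rewrite ltr_wpDr.
  by have := stirling_log_diff_le xn; lra.
move=> /(_ 0%N n (leq0n n)); rewrite addr0 => /le_trans; apply.
by rewrite gerBl divr_ge0// mulr_ge0// addr_ge0// ltW.
Qed.

Definition stirling_lim x : R := limn (fun n => stirling_log (x + n%:R)).

Lemma cvg_stirling_log x : 0 < x ->
  stirling_log (x + n%:R) @[n --> \oo] --> stirling_lim x.
Proof. exact: is_cvg_stirling_log. Qed.

Lemma stirling_limS x : 0 < x -> stirling_lim (x + 1) = stirling_lim x.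
Proof.
move=> x0; apply/cvg_lim => //.
have := cvg_stirling_log x0.
rewrite -(cvg_shiftS (fun n => stirling_log (x + n%:R)))/=.
by under eq_cvg => n do rewrite -natr1 [_ + 1]addrC addrA.
Qed.

Lemma stirling_limD_le x r : 0 < x -> 0 <= r <= 1 ->
  stirling_lim (x + r) <= stirling_lim x.
Proof.
move=> x0 /[dup] r01 /andP[r0 _].
have xr : 0 < x + r by rewrite ltr_wpDr.
have h : stirling_log (x + n%:R) + 2 / (1 * n%:R + x) @[n --> \oo]
    --> stirling_lim x + 0.
  by apply: cvgD; [exact: cvg_stirling_log|exact: cvg_affine_inv].
rewrite -[leRHS]addr0; apply: ler_cvg_to (cvg_stirling_log xr) h _.
apply: nearW => n; rewrite addrAC mul1r [n%:R + x]addrC.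
by apply: stirling_log_step => //; rewrite ltr_wpDr.
Qed.

(** Going from the integer part of [y] to [y], and from [y] to the next integer,
    the limit does not increase; by periodicity the two ends agree. *)
Lemma stirling_lim_cst x : 0 < x -> stirling_lim x = stirling_lim 1.
Proof.
have atn n : stirling_lim n.+1%:R = stirling_lim 1.
  elim: n => [|n IH]; first by [].
  by rewrite -natr1 stirling_limS ?ltr0n.
have step (y : R) : 1 <= y -> stirling_lim y = stirling_lim 1.
  move=> y1; have y0 : 0 <= y by lra.
  have [k /andP[ny yn]] : exists k, k%:R <= y < k.+1%:R.
    by exists (Num.truncn y); exact: truncn_itv.
  case: k ny yn => [|n] ny yn; first by lra.
  rewrite -natr1 in yn.
  apply/eqP; rewrite eq_le; apply/andP; split.
    rewrite -(atn n) -[y in X in X <= _](subrK n.+1%:R) addrC.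
    by apply: stirling_limD_le => //; lra.
  have y0' : 0 < y by lra.
  rewrite -(atn n.+1) -natr1 -[_ + 1 in X in X <= _](subrK y) addrC.
  by apply: stirling_limD_le => //; lra.
move=> x0; rewrite -(stirling_limS x0); apply: step; lra.
Qed.

(** The duplication formula in logarithms; all powers of [2], [n], [pi] and
    [exp 1] cancel except for the last term, which tends to [0]. *)
Lemma stirling_log_double n : stirling_log (2 * n.+1%:R : R) =
  stirling_log (n.+1%:R) + stirling_log (n.+1%:R + 2^-1)
  + (n.+1%:R * (ln (n.+1%:R + 2^-1) - ln n.+1%:R) - 2^-1).
Proof.
have := @Gamma_double R n.+1.
set m : R := n.+1%:R => h.
have m0 : 0 < m by rewrite ltr0n.
have mh : 0 < m + 2^-1 by rewrite addr_gt0.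
have m1 : 0 < m + 1 by rewrite addr_gt0.
have mm : 0 < 2 * m by rewrite mulr_gt0.
have mm1 : 0 < 2 * m + 1 by rewrite addr_gt0.
have spi : 0 < Num.sqrt (pi : R) by rewrite sqrtr_gt0 pi_gt0.
have f4 : 0 < 4 ^+ n.+1 :> R by rewrite exprn_gt0.
have ln4 : ln (4 ^+ n.+1 : R) = m * (2 * ln 2).
  rewrite lnXn// (_ : 4 = 2 ^+ 2 :> R); last by rewrite -natrX.
  by rewrite lnXn// -[LHS]mulr_natl (mulr_natl (ln 2) 2).
move/(congr1 (@ln R)): h.
rewrite !lnM ?posrE ?mulr_gt0 ?Gamma_gt0// ln4 ln_sqrt ?pi_ge0//.
rewrite !stirling_logE// (GammaS mh) !lnM ?posrE ?Gamma_gt0// => h.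
have alg (g0 g1 g2 l2 lm lh lp k : R) :
    g0 + 2^-1 * lp = k * (2 * l2) + g1 + g2 ->
  g0 - (2 * k + 2^-1) * (l2 + lm) + 2 * k - 2^-1 * (l2 + lp) =
  g1 - (k + 2^-1) * lm + k - 2^-1 * (l2 + lp) +
  (lh + g2 - (k + 2^-1 + 2^-1) * lh + (k + 2^-1) - 2^-1 * (l2 + lp)) +
  (k * (lh - lm) - 2^-1).
  move=> /eqP; rewrite -subr_eq0 => /eqP e.
  by apply/eqP; rewrite -subr_eq0 -e; apply/eqP; field.
exact: alg h.
Qed.

(** Passing to the limit in the duplication formula gives [l = l + l]. *)
Lemma stirling_lim1 : stirling_lim 1 = 0 :> R.
Proof.
have l1 : stirling_log (n.+1%:R : R) @[n --> \oo] --> stirling_lim 1.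
  have := cvg_stirling_log (@ltr01 R).
  by under eq_cvg => n do rewrite addrC natr1.
have l2 : stirling_log (n.+1%:R + 2^-1 : R) @[n --> \oo] --> stirling_lim 1.
  have h0 : 0 < 1 + 2^-1 :> R by [].
  rewrite -(stirling_lim_cst h0); have := cvg_stirling_log h0.
  by under eq_cvg => n do rewrite addrAC (addrC 1) natr1.
have l3 : stirling_log (2 * n.+1%:R : R) @[n --> \oo] --> stirling_lim 1.
  have sub : (2 * n).+1 @[n --> \oo] --> \oo.
    by move=> A [N _ NA]; exists N => // n /= Nn; apply: NA => /=; lia.
  have := cvg_comp _ _ sub (cvg_stirling_log (@ltr01 R)).
  rewrite (_ : _ \o _ = fun n => stirling_log (2 * n.+1%:R : R))//.
  apply/funext => n /=; congr stirling_log.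
  by rewrite -natr1 -(natr1 n) natrM; ring.
(* squeezed between [- 1 / (4 n + 6)] and [0] by the tangent bounds on [ln] *)
have l4 : (n.+1%:R * (ln (n.+1%:R + 2^-1) - ln n.+1%:R) - 2^-1 : R)
    @[n --> \oo] --> (0 : R).
  apply: (@squeeze_cvgr _ _ _ _ (fun n => - 1 / (4 * n%:R + 6)) (cst 0)).
  - apply: nearW => n /=.
    have m0 : 0 < n.+1%:R :> R by rewrite ltr0n.
    have mh : 0 < n.+1%:R + 2^-1 :> R by rewrite addr_gt0.
    apply/andP; split.
      rewrite -subr_ge0.
      have := mulr_ge0 (ltW m0) (etrans (subr_ge0 _ _) (lnB_le mh m0)).
      congr (0 <= _); rewrite -natr1; field.
      have n0 : 0 <= n%:R :> R by [].
      by rewrite !gt_eqF//; lra.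
    rewrite -subr_ge0.
    have := mulr_ge0 (ltW m0) (etrans (subr_ge0 _ _) (lnB_le m0 mh)).
    by congr (0 <= _); field; rewrite gt_eqF.
  - exact: cvg_affine_inv.
  - exact: cvg_cst.
have e : (fun n => stirling_log (2 * n.+1%:R : R)) = fun n => stirling_log (n.+1%:R)
    + stirling_log (n.+1%:R + 2^-1)
    + (n.+1%:R * (ln (n.+1%:R + 2^-1) - ln n.+1%:R) - 2^-1).
  by apply/funext => n; exact: stirling_log_double.
have l3' : stirling_log (2 * n.+1%:R : R) @[n --> \oo]
    --> stirling_lim 1 + stirling_lim 1 + (0 : R).
  by rewrite e; apply: cvgD l4; exact: cvgD.
have : stirling_lim 1 = stirling_lim 1 + stirling_lim 1 + 0 :> R.
  exact: (cvg_unique (@Rhausdorff R) l3 l3').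
by lra.
Qed.

Lemma stirling_log_cvg0 x : 0 < x ->
  stirling_log (x + n%:R) @[n --> \oo] --> (0 : R).
Proof.
by move=> x0; rewrite -stirling_lim1 -(stirling_lim_cst x0); exact: cvg_stirling_log.
Qed.

Lemma stirling_log_le x : 0 < x -> stirling_log x <= 1 / (12 * x).
Proof.
move=> x0.
have := @ler_of_decrements (fun n => stirling_log (x + n%:R))
  (fun n => 1 / (12 * (x + n%:R))).
rewrite addr0; apply.
- move=> n; rewrite -(natr1 n) addrA; apply: stirling_log_diff_le.
  by rewrite ltr_wpDr.
- exact: stirling_log_cvg0.
- under eq_cvg do rewrite mulrDr addrC.
  exact: cvg_affine_inv.
Qed.

(** The hypothesis on [s] and [x0] says that
    [(y + s)^2 - 1 >= y^2] at [y = 2 * x0 + 1], hence at all larger [y]. *)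
Lemma stirling_log_ge (s x0 x : R) : 0 <= s -> 1 <= 2 * (2 * x0 + 1) * s + s ^+ 2 ->
  0 <= x0 <= x -> 0 < x -> 1 / (12 * x + 6 * s) <= stirling_log x.
Proof.
move=> s0 hs /andP[x00 x0x] xpos.
have := @ler_of_decrements (fun n => 1 / (12 * (x + n%:R) + 6 * s))
  (fun n => stirling_log (x + n%:R)).
rewrite addr0; apply; last exact: stirling_log_cvg0.
- move=> n; rewrite -(natr1 n) addrA.
  have xn : 0 < x + n%:R by rewrite ltr_wpDr.
  apply: le_trans (stirling_log_diff_ge xn).
  have : x0 <= x + n%:R by rewrite ler_wpDr.
  move: (x + n%:R) xn => y y0 x0y.
  have d0 : 0 < 2 * y + 1 by lra.
  have d1 : 0 < 12 * y + 6 * s by lra.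
  have d2 : 0 < 12 * (y + 1) + 6 * s by lra.
  have -> : 1 / (12 * y + 6 * s) - 1 / (12 * (y + 1) + 6 * s)
      = 12 / ((12 * y + 6 * s) * (12 * (y + 1) + 6 * s)).
    by field; rewrite !gt_eqF.
  rewrite ler_pdivrMr ?mulr_gt0// mulrAC ler_pdivlMr ?mulr_gt0 ?exprn_gt0//.
  have : 0 <= (y - x0) * s by rewrite mulr_ge0 ?subr_ge0.
  move: hs; lra.
- under eq_cvg do rewrite mulrDr -addrA addrCA.
  exact: cvg_affine_inv.
Qed.

End stirling.

Theorem theorem26 (R : realType) :
  (forall x : R, 0 < x ->
     expR (1 / (12 * x + 6 * (Num.sqrt 2 - 1))) <= Pi x / S_ 0 x
       <= expR (1 / (12 * x))) /\
  (forall x : R, 0 <= x ->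
     expR (1 / (12 * x + 6 * (Num.sqrt 10 - 1))) <= Pi x / S_ 1 x
       <= expR (1 / (12 * x + 12))).
Proof.
split=> x x0.
  have q0 : 0 <= Num.sqrt 2 :> R := sqrtr_ge0 _.
  have q2 : Num.sqrt 2 ^+ 2 = 2 :> R by rewrite sqr_sqrtr.
  have q1 : 1 <= Num.sqrt 2 :> R by nra.
  rewrite stirling_ratioE// !ler_expR stirling_log_le// andbT.
  apply: (@stirling_log_ge _ _ 0) => //; [lra|nra|by rewrite lexx ltW].
have q0 : 0 <= Num.sqrt 10 :> R := sqrtr_ge0 _.
have q2 : Num.sqrt 10 ^+ 2 = 10 :> R by rewrite sqr_sqrtr.
have q1 : 3 <= Num.sqrt 10 :> R by nra.
have x1 : 0 < x + 1 by lra.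
rewrite stirling_ratio1E// stirling_ratioE// !ler_expR.
rewrite (_ : 12 * x + 6 * (Num.sqrt 10 - 1)
  = 12 * (x + 1) + 6 * (Num.sqrt 10 - 3)); last by ring.
rewrite (_ : 12 * x + 12 = 12 * (x + 1)); last by ring.
rewrite stirling_log_le// andbT.
apply: (@stirling_log_ge _ _ 1) => //; [lra|nra|lra].
Qed.
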